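(* Let $\mathbb K$ be a commutative field and $\mathcal X$ a finite set of free non-commuting variables. For every invertible series $A\in\mathbb K\langle\!\langle\mathcal X\rangle\!\rangle^*$ one has the equality of subspaces $$\overline{A^{-1}}+\mathbb K=A^{-1}(\overline A+\mathbb K)$$ of $\mathbb K\langle\!\langle\mathcal X\rangle\!\rangle$.
   Context: $\mathcal X^*$ is the free monoid on $\mathcal X$. $\mathbb K\langle\!\langle\mathcal X\rangle\!\rangle$ is the algebra of non-commutative formal power series $A=\sum_{\mathbf X\in\mathcal X^*}(A,\mathbf X)\mathbf X$ with the convolution product. $\mathbb K\langle\!\langle\mathcal X\rangle\!\rangle^*$ is its group of units (the series with non-zero constant coefficient). For $\mathbf T\in\mathcal X^*$ the shift map is $\rho(\mathbf T)A=\sum_{\mathbf X\in\mathcal X^*}(A,\mathbf X\mathbf T)\mathbf X$. The recursive closure $\overline A$ is the linear span of $\{\rho(\mathbf T)A:\mathbf T\in\mathcal X^*\}$ (possibly infinite-dimensional). $\mathbb K$ is identified with the space of constant series. For a subspace $E$, $A^{-1}E=\{A^{-1}e : e\in E\}$. *)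

(* Defs.v *)
From HB Require Import structures.
From mathcomp Require Import all_boot all_algebra.
From mathcomp Require Import boolp classical_sets functions.

Set Implicit Arguments.
Unset Strict Implicit.
Unset Printing Implicit Defensive.

Import GRing.Theory.
Local Open Scope classical_set_scope.
Local Open Scope ring_scope.

(* The free monoid X^* is [seq X] with concatenation; the series A is its
   coefficient function, so (A, W) is [A W].  The alias keeps the convolution
   product below apart from the pointwise product of functions. *)
Definition ncseries (K : fieldType) (X : finType) : Type := seq X -> K.

Section NCSeries.
Context (K : fieldType) (X : finType).
Local Notation S := (ncseries K X).
Implicit Types (A B C : S) (w : seq X).

(* [K^o] is K as a module over itself: the linear structure is pointwise. *)
HB.instance Definition _ := GRing.Lmodule.copy S (seq X -> K^o).

Definition ncs_one : S := fun w => (w == [::])%:R.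

Definition ncs_mul A B : S :=
  fun w => \sum_(i < (size w).+1) A (take i w) * B (drop i w).

Lemma ncs_addE A B w : (A + B) w = A w + B w. Proof. by []. Qed.
Lemma ncs_scaleE a A w : (a *: A) w = a * A w. Proof. by []. Qed.

Let lquot (x : X) A : S := fun w => A (x :: w).

Lemma ncs_mul_nil A B : ncs_mul A B [::] = A [::] * B [::].
Proof. by rewrite /ncs_mul big_ord1. Qed.

Lemma ncs_mul_cons A B x w :
  ncs_mul A B (x :: w) = A [::] * B (x :: w) + ncs_mul (lquot x A) B w.
Proof. by rewrite /ncs_mul big_ord_recl take0 drop0. Qed.

Lemma ncs_mulDl : left_distributive ncs_mul +%R.
Proof.
move=> A B C; apply/funext => w; rewrite ncs_addE /ncs_mul -big_split /=.
by apply: eq_bigr => i _; rewrite ncs_addE mulrDl.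
Qed.

Lemma ncs_mulDr : right_distributive ncs_mul +%R.
Proof.
move=> A B C; apply/funext => w; rewrite ncs_addE /ncs_mul -big_split /=.
by apply: eq_bigr => i _; rewrite ncs_addE mulrDr.
Qed.

Lemma ncs_scalerAl a A B : a *: ncs_mul A B = ncs_mul (a *: A) B.
Proof.
apply/funext => w; rewrite ncs_scaleE /ncs_mul big_distrr /=.
by apply: eq_bigr => i _; rewrite ncs_scaleE mulrA.
Qed.

Lemma ncs_scalerAr a A B : a *: ncs_mul A B = ncs_mul A (a *: B).
Proof.
apply/funext => w; rewrite ncs_scaleE /ncs_mul big_distrr /=.
by apply: eq_bigr => i _; rewrite ncs_scaleE mulrCA.
Qed.

Lemma ncs_mulA : associative ncs_mul.
Proof.
move=> A B C; apply/funext => w; elim: w A => [|x w IHw] A.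
  by rewrite !ncs_mul_nil mulrA.
rewrite !ncs_mul_cons ncs_mul_nil IHw.
have -> : lquot x (ncs_mul A B) =
    A [::] *: lquot x B + ncs_mul (lquot x A) B.
  by apply/funext => v; rewrite ncs_addE ncs_scaleE /lquot ncs_mul_cons.
by rewrite ncs_mulDl ncs_addE -ncs_scalerAl ncs_scaleE mulrDr mulrA addrA.
Qed.

Lemma ncs_mul1l : left_id ncs_one ncs_mul.
Proof.
move=> A; apply/funext => w; rewrite /ncs_mul big_ord_recl take0 drop0.
rewrite mul1r big1 ?addr0 // => i _; case: w i => [[]//|x w] i.
by rewrite /ncs_one /= mul0r.
Qed.

Lemma ncs_mul1r : right_id ncs_one ncs_mul.
Proof.
move=> A; apply/funext => w; rewrite /ncs_mul big_ord_recr /=.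
rewrite take_size drop_size.
rewrite mulr1 big1 ?add0r // => i _.
by rewrite /ncs_one -size_eq0 size_drop subn_eq0 leqNgt ltn_ord mulr0.
Qed.

Lemma ncs_one_neq0 : ncs_one != 0.
Proof.
apply/eqP => /(congr1 (fun A : S => A [::])); rewrite /ncs_one eqxx.
exact/eqP/oner_neq0.
Qed.

HB.instance Definition _ := GRing.Zmodule_isNzRing.Build S
  ncs_mulA ncs_mul1l ncs_mul1r ncs_mulDl ncs_mulDr ncs_one_neq0.
HB.instance Definition _ := GRing.Lmodule_isLalgebra.Build K S ncs_scalerAl.
HB.instance Definition _ := GRing.Lalgebra_isAlgebra.Build K S ncs_scalerAr.

Lemma ncs_mulE A B w :
  (A * B) w = \sum_(i < (size w).+1) A (take i w) * B (drop i w).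
Proof. by []. Qed.

Lemma ncs_sumE (I : Type) (r : seq I) (P : pred I) (F : I -> S) w :
  (\sum_(i <- r | P i) F i) w = \sum_(i <- r | P i) F i w.
Proof. by elim/big_rec2: _ => // i y z _ <-. Qed.

Lemma ncs_exp_small A k w : A [::] = 0 -> (size w < k)%N -> (A ^+ k) w = 0.
Proof.
move=> A0; elim: k w => // k IHk w lt_wk; rewrite exprS ncs_mulE.
rewrite big1 // => i _; case: w i lt_wk => [|x w] i lt_wk.
  by rewrite /= A0 mul0r.
have [->|i0] := posnP i; first by rewrite take0 A0 mul0r.
rewrite IHk ?mulr0 // size_drop; apply: (@leq_ltn_trans (size w)) lt_wk.
by rewrite leq_subLR; exact: leq_add i0 (leqnn (size w)).
Qed.

Definition ncs_unit : pred S := fun A => A [::] != 0.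

(* Writing A = a (1 - C) with a = (A, 1), the inverse is the geometric series
   of C divided by a; C has no constant term, so its powers beyond the length
   of a word do not contribute to the coefficient of that word. *)
Definition ncs_inv A : S :=
  if ncs_unit A then
    fun w => (A [::])^-1 *
             (\sum_(k < (size w).+1) (1 - (A [::])^-1 *: A) ^+ k) w
  else A.

Lemma ncs_constC A : ncs_unit A -> (1 - (A [::])^-1 *: A) [::] = 0.
Proof.
move=> uA; rewrite ncs_addE [X in _ + X](_ : _ = - 1) ?subrr //.
by rewrite -[X in _ = - X](mulVf uA).
Qed.

Lemma ncs_invE A n w : ncs_unit A -> (size w <= n)%N ->
  ncs_inv A w =
    ((A [::])^-1 *: \sum_(k < n.+1) (1 - (A [::])^-1 *: A) ^+ k) w.
Proof.
move=> uA le_wn; rewrite /ncs_inv uA ncs_scaleE !ncs_sumE; congr (_ * _).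
rewrite -!(big_mkord xpredT (fun k => ((1 - (A [::])^-1 *: A) ^+ k) w)).
rewrite [RHS](@big_cat_nat _ _ _ (size w).+1) //=.
rewrite [X in _ = _ + X]big1_seq ?addr0 //.
move=> k /andP[_]; rewrite mem_index_iota => /andP[lt_wk _].
by rewrite ncs_exp_small // ncs_constC.
Qed.

Lemma ncs_scale1C A : ncs_unit A ->
  A = A [::] *: (1 - (1 - (A [::])^-1 *: A)).
Proof. by move=> uA; rewrite opprB addrC subrK scalerA divff // scale1r. Qed.

Lemma ncs_mulVr : {in ncs_unit, left_inverse 1 ncs_inv *%R}.
Proof.
move=> A uA; apply/funext => w; set n := size w.
transitivity
  (((A [::])^-1 *: \sum_(k < n.+1) (1 - (A [::])^-1 *: A) ^+ k * A) w).
  rewrite -mulr_suml ncs_scaleE !ncs_mulE big_distrr /=.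
  apply: eq_bigr => i _; rewrite (@ncs_invE _ n) // ?ncs_scaleE ?mulrA //.
  by rewrite size_take_min geq_minr.
have C0 := ncs_constC uA; rewrite -mulr_suml {4}(ncs_scale1C uA).
set C := 1 - _ *: _ in C0 *; rewrite -scalerAr scalerA mulVf // scale1r.
have cC : GRing.comm (\sum_(k < n.+1) C ^+ k) (1 - C).
  apply: commrB; first exact: commr1.
  by apply/commr_sym/commr_sum => i _; apply: commrX.
rewrite cC -opprB mulNr -subrX1 opprB ncs_addE.
rewrite [X in _ + X](_ : _ = - (C ^+ n.+1) w) //.
by rewrite ncs_exp_small // oppr0 addr0.
Qed.

Lemma ncs_divrr : {in ncs_unit, right_inverse 1 ncs_inv *%R}.
Proof.
move=> A uA; apply/funext => w; set n := size w.
transitivity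
  (((A [::])^-1 *: (A * \sum_(k < n.+1) (1 - (A [::])^-1 *: A) ^+ k)) w).
  rewrite ncs_scaleE !ncs_mulE big_distrr /=.
  apply: eq_bigr => i _; rewrite (@ncs_invE _ n) // ?ncs_scaleE 1?mulrCA //.
  by rewrite size_drop leq_subr.
have C0 := ncs_constC uA; rewrite {2}(ncs_scale1C uA).
set C := 1 - _ *: _ in C0 *; rewrite -scalerAl scalerA mulVf // scale1r.
rewrite -opprB mulNr -subrX1 opprB ncs_addE.
rewrite [X in _ + X](_ : _ = - (C ^+ n.+1) w) //.
by rewrite ncs_exp_small // oppr0 addr0.
Qed.

Lemma ncs_unitrP A B : B * A = 1 /\ A * B = 1 -> ncs_unit A.
Proof.
move=> [_ /(congr1 (fun D : S => D [::]))]; rewrite ncs_mulE big_ord1 /=.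
rewrite /ncs_unit; apply: contra_eq_neq => ->.
by rewrite mul0r eq_sym oner_neq0.
Qed.

Lemma ncs_inv_out : {in [predC ncs_unit], ncs_inv =1 id}.
Proof. by move=> A /negbTE uA; rewrite /ncs_inv [ncs_unit A]uA. Qed.

HB.instance Definition _ := GRing.NzRing_hasMulInverse.Build S
  ncs_mulVr ncs_divrr ncs_unitrP ncs_inv_out.

Lemma ncs_unitE A : (A \is a GRing.unit) = (A [::] != 0). Proof. by []. Qed.

Definition ncs_shift (t : seq X) A : S := fun w => A (w ++ t).

Definition lin_span (V : lmodType K) (E : set V) : set V :=
  [set v | exists n (c : 'I_n -> K) (e : 'I_n -> V),
     (forall i, E (e i)) /\ v = \sum_(i < n) c i *: e i].

Definition rec_closure A : set S :=
  lin_span [set ncs_shift t A | t in [set: seq X]].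

Definition const_series : set S := [set c%:A | c in [set: K]].

Definition add_subspace (V : lmodType K) (E F : set V) : set V :=
  [set x + y | x in E & y in F].

Definition mull_subspace A (E : set S) : set S := [set A * e | e in E].

End NCSeries.

Arguments const_series : clear implicits.

(* Main.v *)
Require Import Defs.
From mathcomp Require Import all_boot all_algebra.
From mathcomp Require Import boolp classical_sets functions.
Local Open Scope ring_scope.

(** Shifting by a letter x is a twisted derivation:
    rho(x)(AB) = A rho(x)B + (B,1) rho(x)A.  Applied to A A^-1 = 1 it gives
    rho(x)A^-1 = - (A^-1,1) A^-1 rho(x)A, so the subspace A^-1(\bar A + K),
    which contains K = A^-1(K A) and A^-1, is stable under all shifts and
    hence contains \bar{A^-1} + K.  The reverse inclusion is the same one for
    A^-1, multiplied by A^-1. *)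

Import GRing.Theory.
Local Open Scope classical_set_scope.

Definition is_subspace {K : fieldType} {V : lmodType K} (E : set V) : Prop :=
  E 0 /\ forall a u v, E u -> E v -> E (a *: u + v).

Section Subspaces.
Context {K : fieldType} {V : lmodType K}.
Implicit Types E F : set V.

Lemma is_subspaceZ E a u : is_subspace E -> E u -> E (a *: u).
Proof. by move=> [E0 EZD] Eu; rewrite -[_ *: _]addr0; exact: EZD. Qed.

Lemma is_subspaceD E u v : is_subspace E -> E u -> E v -> E (u + v).
Proof. by move=> [E0 EZD] Eu Ev; rewrite -[u]scale1r; exact: EZD. Qed.

Lemma lin_span_min E F : is_subspace F -> E `<=` F -> lin_span E `<=` F.
Proof.
move=> sF sEF _ [n [c [e [Ee ->]]]].
elim/big_ind: _ => [|u v|i _]; first by case: sF.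
  exact: is_subspaceD.
by apply: is_subspaceZ => //; exact: sEF.
Qed.

Lemma sub_lin_span E : E `<=` lin_span E.
Proof.
move=> v Ev; exists 1%N, (fun=> 1), (fun=> v); split=> //.
by rewrite big_ord1 scale1r.
Qed.

Lemma lin_span_subspace E : is_subspace (lin_span E).
Proof.
split.
  exists 0%N, (fun=> 0), (fun=> 0); split; first by case.
  by rewrite big_ord0.
move=> a _ _ [n [c [e [Ee ->]]]] [m [d [f [Ef ->]]]].
(* Two linear combinations are added by concatenating their families; [a] is absorbed into the
   coefficients of the first. *)
exists (n + m)%N,
  (fun i : 'I_(n + m) => match fintype.split i with inl j => a * c j | inr j => d j end),
  (fun i : 'I_(n + m) => match fintype.split i with inl j => e j | inr j => f j end); split.
  by move=> i; case: (fintype.split i).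
rewrite big_split_ord /= scaler_sumr; congr (_ + _); apply: eq_bigr => i _.
  by rewrite -[lshift _ _]/(unsplit (inl i)) unsplitK scalerA.
by rewrite -[rshift _ _]/(unsplit (inr i)) unsplitK.
Qed.

Lemma add_subspaceP E F :
  is_subspace E -> is_subspace F -> is_subspace (add_subspace E F).
Proof.
move=> [E0 EZD] [F0 FZD]; split; first by exists 0 => //; exists 0; rewrite ?addr0.
move=> a _ _ [u Eu [v Fv <-]] [u' Eu' [v' Fv' <-]].
exists (a *: u + u'); first exact: EZD.
by exists (a *: v + v'); [exact: FZD | rewrite scalerDr addrACA].
Qed.

End Subspaces.

Section Shifts.
Context {K : fieldType} {X : finType}.
Local Notation S := (ncseries K X).
Implicit Types (A B : S) (E : set S).

Lemma const_series_subspace : is_subspace (const_series K X).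
Proof.
split; first by exists 0 => //; rewrite scale0r.
move=> a _ _ [c _ <-] [d _ <-]; exists (a * c + d) => //.
by rewrite scalerDl scalerA.
Qed.

Lemma mull_subspaceP A E : is_subspace E -> is_subspace (mull_subspace A E).
Proof.
move=> [E0 EZD]; split; first by exists 0; rewrite ?mulr0.
move=> a _ _ [u Eu <-] [v Ev <-]; exists (a *: u + v); first exact: EZD.
by rewrite mulrDr scalerAr.
Qed.

Lemma ncs_shift_nil A : ncs_shift [::] A = A.
Proof. by apply/funext => w; rewrite /ncs_shift cats0. Qed.

(** Shifts form a left action of the free monoid by associativity of concatenation, so every shift
    is a composite of one-letter shifts. *)
Lemma ncs_shift_cat s t A : ncs_shift (s ++ t) A = ncs_shift s (ncs_shift t A).
Proof. by apply/funext => w; rewrite /ncs_shift catA. Qed.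

Lemma ncs_shiftZD t a A B :
  ncs_shift t (a *: A + B) = a *: ncs_shift t A + ncs_shift t B.
Proof. by []. Qed.

Lemma ncs_shift_const t c :
  t != [::] -> ncs_shift t (c%:A : S) = 0.
Proof.
move=> tN0; apply/funext => w; rewrite /ncs_shift ncs_scaleE.
rewrite (_ : (1 : S) _ = (w ++ t == [::])%:R) //.
by case: w t tN0 => [|y w] [|z t] //= _; rewrite mulr0.
Qed.

(** A cut of the word [w ++ [:: x]] either leaves [x] in the right factor, which gives the first
    term, or has an empty right factor, which gives the second. *)
Lemma ncs_shift_letter_mul x A B :
  ncs_shift [:: x] (A * B) =
  A * ncs_shift [:: x] B + B [::] *: ncs_shift [:: x] A.
Proof.
apply/funext => w; rewrite ncs_addE ncs_scaleE /ncs_shift !ncs_mulE.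
rewrite size_cat addn1 big_ord_recr /=; congr (_ + _); last first.
  by rewrite take_oversize ?drop_oversize ?size_cat ?addn1 // mulrC.
apply: eq_bigr => i _; have le_iw : (i <= size w)%N by rewrite -ltnS.
(* Only the cut at [i = size w] needs care: the right factor is then exactly [[:: x]]. *)
rewrite takel_cat // drop_cat; case: ltngtP le_iw => // -> _.
by rewrite subnn drop0 drop_size.
Qed.

Lemma ncs_shift_letter_inv x A : A \is a GRing.unit ->
  ncs_shift [:: x] A^-1 = - (A^-1 [::] *: (A^-1 * ncs_shift [:: x] A)).
Proof.
move=> uA; have := ncs_shift_letter_mul x A A^-1.
(* The product is the constant series 1, which every nonempty shift kills. *)
rewrite divrr // -[1]scale1r ncs_shift_const // => /esym/eqP.
rewrite addr_eq0 => /eqP /(congr1 (fun B => A^-1 * B)).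
by rewrite mulKr // mulrN -scalerAr.
Qed.

Lemma rec_closure_shift A t : rec_closure A (ncs_shift t A).
Proof. by apply: sub_lin_span; exists t. Qed.

(** The preimage of the closure under a shift is a subspace, by linearity, and contains the
    generators, since a shift of a shift of [A] is again a shift of [A]. *)
Lemma rec_closure_stable A B t :
  rec_closure A B -> rec_closure A (ncs_shift t B).
Proof.
have [cA0 cAZD] : is_subspace (rec_closure A) by exact: lin_span_subspace.
apply: (@lin_span_min _ _ _ [set B | rec_closure A (ncs_shift t B)]).
  by split=> // a u v; exact: cAZD.
move=> _ [s _ <-] /=; rewrite -ncs_shift_cat; exact: rec_closure_shift.
Qed.

(** Stability under single letters suffices, by induction on the word: its first letter is the shift
    applied last. *)
Lemma rec_closure_min A E : is_subspace E -> E A ->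
  (forall x B, E B -> E (ncs_shift [:: x] B)) -> rec_closure A `<=` E.
Proof.
move=> sE EA EX; apply: lin_span_min => // _ [t _ <-].
elim: t => [|x t IHt]; first by rewrite ncs_shift_nil.
by rewrite -cat1s ncs_shift_cat; exact: EX.
Qed.

Lemma sub_rec_closure_inv A : A \is a GRing.unit ->
  add_subspace (rec_closure A^-1) (const_series K X) `<=`
  mull_subspace A^-1 (add_subspace (rec_closure A) (const_series K X)).
Proof.
move=> uA; set F := add_subspace (rec_closure A) _.
have sA : is_subspace (rec_closure A) by exact: lin_span_subspace.
have AA : rec_closure A A.
  by have := rec_closure_shift A [::]; rewrite ncs_shift_nil.
have sF : is_subspace F.
  by apply: add_subspaceP => //; exact: const_series_subspace.
have sAF : rec_closure A `<=` F.
  by move=> u Au; exists u => //; exists 0;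
    rewrite ?addr0 //; case: const_series_subspace.
have sG := mull_subspaceP A^-1 _ sF.
move=> _ [u Mu [_ [c _ <-] <-]]; apply: (is_subspaceD _ _ _ sG); last first.
  exists (c *: A); last by rewrite -scalerAr mulVr.
  by apply: sAF; exact: (is_subspaceZ _ _ _ sA AA).
apply: (rec_closure_min _ _ sG _ _ _ Mu).
  (* [A^-1] is [A^-1 * 1], and 1 comes from the constant summand. *)
  exists 1; last by rewrite mulr1.
  exists 0; first by case: sA.
  by exists 1; [exists 1; rewrite ?scale1r | rewrite add0r].
move=> x _ [_ [v Av [_ [d _ <-] <-]] <-].
(* With [d] standing for its constant series and [b] for the constant term of [v + d], the shift of
   [A^-1 * (v + d)] is [A^-1] times the shift of [v] minus [b * A^-1 [::]] times the shift of [A];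
   the shift of [d] vanishes. *)
rewrite ncs_shift_letter_mul ncs_shift_letter_inv //.
rewrite -scaleNr !scalerAr -mulrDr.
rewrite -[v in ncs_shift _ (v + _)]scale1r ncs_shiftZD scale1r.
rewrite ncs_shift_const // addr0.
eexists; last by []; apply: sAF; apply: is_subspaceD => //.
  exact: rec_closure_stable.
by do 2!apply: is_subspaceZ => //; exact: rec_closure_shift.
Qed.

End Shifts.

Theorem proposition5p5 (K : fieldType) (X : finType) (A : ncseries K X)
    (unitA : A \is a GRing.unit) :
  add_subspace (rec_closure A^-1) (const_series K X) =
  mull_subspace A^-1 (add_subspace (rec_closure A) (const_series K X)).
Proof.
apply/seteqP; split; first exact: sub_rec_closure_inv.
have uV : A^-1 \is a GRing.unit by rewrite unitrV.
(* The inclusion for [A^-1] writes [e] as [A * f] with [f] in the left-hand side, so [A^-1 * e] is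
   [f]. *)
move=> _ [e Fe <-]; have := @sub_rec_closure_inv _ _ A^-1 uV e.
by rewrite invrK => /(_ Fe)[f Gf <-]; rewrite mulKr.
Qed.
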